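(* Let $N\ge9$, $\alpha\in\{2,3,4\}$ with $\alpha\mid N$, and $M_\alpha=N/\alpha$. Let $g$ be a $2\times5$ matrix over $\mathbb{Z}_N$ generating an admissible linear code, with columns indexed by $i=0,\dots,4$ and $\gcd_i=\gcd(g_{1i},g_{2i},N)$. Suppose exactly two columns of $g$ have $\gcd_i=M_\alpha$ and the other columns have $\gcd_i<M_\alpha$. Then $g$ cannot generate a thin non-degenerate linear code.
   Context: $\mathbb{Z}_N=\mathbb{Z}/N\mathbb{Z}$; its elements are identified with the representatives $0,1,\dots,N-1$, and gcd's are taken of these integers. The code generated by $g$ is the submodule of $\mathbb{Z}_N^5$ generated by the rows of $g$. A linear code is extended if every word has coordinate sum $0\bmod N$; call it admissible if it is extended and the greatest common divisor of $N$ and all entries of all words (equivalently of $N$ and all entries of $g$) is $1$. It is degenerate if some coordinate is zero in all words. An extended code is thin if it contains no word all of whose entries are nonzero. *)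

(* Defs.v *)
From HB Require Import structures.
From mathcomp Require Import all_boot all_order all_algebra.

Set Implicit Arguments.
Unset Strict Implicit.
Unset Printing Implicit Defensive.

Import GRing.Theory.
Local Open Scope ring_scope.

(* The modulus is an arbitrary nat [N]; since ['Z_N] is Z/NZ only when
   [1 < N], these notions are meaningful under that assumption.  An element
   of ['Z_N] coerces to its representative in {0, ..., N-1}. *)

Definition gen_code (N k n : nat) (g : 'M['Z_N]_(k, n)) : {set 'rV['Z_N]_n} :=
  [set u *m g | u : 'rV['Z_N]_k].

Definition extended (N n : nat) (C : {set 'rV['Z_N]_n}) : Prop :=
  forall w, w \in C -> \sum_(i < n) w 0 i = 0.

Definition code_gcd (N n : nat) (C : {set 'rV['Z_N]_n}) : nat :=
  \big[gcdn/N]_(w in C) \big[gcdn/0%N]_(i < n) (w 0 i : nat).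

Definition admissible (N n : nat) (C : {set 'rV['Z_N]_n}) : Prop :=
  extended C /\ code_gcd C = 1%N.

Definition degenerate (N n : nat) (C : {set 'rV['Z_N]_n}) : Prop :=
  exists i : 'I_n, forall w, w \in C -> w 0 i = 0.

Definition thin (N n : nat) (C : {set 'rV['Z_N]_n}) : Prop :=
  extended C /\ ~ (exists2 w, w \in C & forall i : 'I_n, w 0 i != 0).

Definition col_gcd (N n : nat) (g : 'M['Z_N]_(2, n)) (i : 'I_n) : nat :=
  gcdn (gcdn (g 0 i) (g 1 i)) N.

(* Main.v *)
(** Column [i] of [g] is a homomorphism [phi i] from Z_N^2 to Z_N, and the code
    is thin iff the kernels of the five [phi i] cover Z_N^2.  Let [a], [b] be the
    two columns of gcd N/alpha, [c], [d], [e] the other ones, and [L] the common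
    kernel of [phi a] and [phi b].  For every [x] outside both of these kernels,
    [x + L] is covered by the zero sets of [phi c], [phi d], [phi e]; on [L] these
    maps sum to zero, and none of them vanishes since [L] contains the multiples
    of alpha.  As Z_N has only one involution, two of the maps never suffice,
    so each of them has a zero on [x + L]; a pigeonhole argument along arithmetic
    progressions shows that on [L] either all three are killed by 3, or all are
    killed by 4 and one of them by 2.  If alpha = 2, all columns are then killed
    by 6 or by 8, so admissibility gives N <= 8.  If alpha > 2, the elements
    outside both kernels generate Z_N^2, so one of [phi c], [phi d], [phi e] is
    killed everywhere by some k <= 3 <= alpha, against its gcd being less than
    N/alpha. *)
Require Import Defs.
From HB Require Import structures.
From mathcomp Require Import all_boot all_order all_algebra.

Set Implicit Arguments.
Unset Strict Implicit.
Unset Printing Implicit Defensive.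

Import GRing.Theory.
Local Open Scope ring_scope.

(** * Subgroups covered by cosets of kernels *)

Section CosetCovers.

Variables (V : finZmodType) (A : zmodType) (L : zmodClosed V).
Implicit Types f d e : {additive V -> A}.

Definition killed n f := [forall (y | y \in L), f y *+ n == 0].
Definition sum_zero f d e := forall y, y \in L -> f y + d y + e y = 0.

Lemma killedP n f : reflect (forall y, y \in L -> f y *+ n = 0) (killed n f).
Proof. by apply: (iffP 'forall_implyP) => h y Ly; apply/eqP/h. Qed.

Lemma killedPn n f :
  reflect (exists2 y, y \in L & f y *+ n != 0) (~~ killed n f).
Proof.
rewrite negb_forall; apply: (iffP existsP) => -[y].
  by rewrite negb_imply => /andP[]; exists y.
by move=> Ly fy; exists y; rewrite negb_imply Ly.
Qed.

(** If neither [u] nor [v] works, each lies in the kernel avoided by the other, so [u + v] avoids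
    both. *)
Lemma avoid_kernels m n f d u v : f u *+ m != 0 -> d v *+ n != 0 ->
  exists2 y, y \in [:: u; v; u + v] & (f y *+ m != 0) && (d y *+ n != 0).
Proof.
move=> fu dv.
have [du|du] := eqVneq (d u *+ n) 0; last by exists u; rewrite ?inE ?eqxx ?fu.
have [fv|fv] := eqVneq (f v *+ m) 0; last first.
  by exists v; rewrite ?inE ?eqxx ?orbT ?fv.
exists (u + v); first by rewrite !inE eqxx !orbT.
by rewrite !raddfD !mulrnDl du fv add0r addr0 fu.
Qed.

Lemma not_killed_pair m n f d : ~~ killed m f -> ~~ killed n d ->
  exists y, [/\ y \in L, f y *+ m != 0 & d y *+ n != 0].
Proof.
move=> /killedPn[u Lu fu] /killedPn[v Lv dv].
have [y yuv /andP[fy dy]] := avoid_kernels fu dv; exists y; split=> //.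
by move: yuv; rewrite !inE => /or3P[] /eqP-> //; apply: rpredD.
Qed.

(** A group is not the union of two proper subgroups. *)
Lemma killed_or m n f :
  (forall y, y \in L -> f y *+ m = 0 \/ f y *+ n = 0) ->
  killed m f || killed n f.
Proof.
move=> h; apply/negPn; rewrite negb_or; apply/negP => /andP[nm nn].
have [y [Ly /eqP fm /eqP fn]] := not_killed_pair nm nn.
by case: (h y Ly).
Qed.

(** Translation by a [w] outside both kernels swaps the cosets [d = q] and [e = r], so [d w] and
    [e w] are involutions, hence equal. Then [d + e], and with it [f], is constant on [L], and
    [f 0 = 0]. *)
Lemma two_coset_cover f d e q r :
  (forall s t : A, s *+ 2 = 0 -> t *+ 2 = 0 -> s != 0 -> t != 0 -> s = t) ->
  sum_zero f d e -> ~~ killed 1 d -> ~~ killed 1 e ->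
  (forall y, y \in L -> d y = q \/ e y = r) -> killed 1 f.
Proof.
move=> inv sum0 nd ne cov.
have [w [Lw dw ew]] := not_killed_pair nd ne.
rewrite !mulr1n in dw ew.
have DE y : y \in L -> d y = q -> e (y + w) = r.
  move=> Ly dy; case: (cov (y + w)) => [|dyw|//]; first exact: rpredD.
  by case/eqP: dw; apply: (addrI q); rewrite addr0 -{2}dyw raddfD dy.
have ED y : y \in L -> e y = r -> d (y + w) = q.
  move=> Ly ey; case: (cov (y + w)) => [|//|eyw]; first exact: rpredD.
  by case/eqP: ew; apply: (addrI r); rewrite addr0 -{2}eyw raddfD ey.
have L1 y : y \in L -> y + w \in L by move=> Ly; apply: rpredD.
have dbl (c : {additive V -> A}) y : c (y + w + w) = c y -> c w *+ 2 = 0.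
  by rewrite !raddfD /= -addrA -[RHS]addr0 => /addrI.
have [y Ly dy] : exists2 y, y \in L & d y = q.
  have L0 := rpred0 L.
  by case: (cov 0 L0) => [|/(ED _ L0)]; [exists 0 | exists (0 + w); rewrite ?L1].
have dw2 : d w *+ 2 = 0 by apply: (dbl _ y); rewrite (ED (y + w)) ?L1 ?DE.
have ew2 : e w *+ 2 = 0.
  by apply: (dbl _ (y + w)); rewrite (DE (y + w + w)) ?(ED (y + w)) ?L1 ?DE.
have dew := inv _ _ dw2 ew2 dw ew.
have de z : z \in L -> d z + e z = q + r - d w.
  move=> Lz; case: (cov z Lz) => hz.
    by rewrite -(DE z Lz hz) hz raddfD -dew addrA addrK.
  by rewrite -(ED z Lz hz) hz raddfD addrAC addrK.
have fE z : z \in L -> f z = - (q + r - d w).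
  by move=> Lz; apply/eqP; rewrite -addr_eq0 -(de z Lz) addrA sum0.
apply/killedP => z Lz; rewrite mulr1n fE // -(fE 0) ?rpred0 //.
exact: raddf0.
Qed.

(** * Pigeonhole along progressions in a three-coset cover *)

Section ThreeCosets.

Variables (f d e : {additive V -> A}) (p q r : A).
Hypothesis sum0 : sum_zero f d e.
Hypothesis cov : forall y, y \in L -> [\/ f y = p, d y = q | e y = r].

(** On [y], [y + w], [y + w *+ 2] the map [f] stays away from [p], so two of these points share
    [d = q] or share [e = r]; as [e w = - d w], either way [d w] or [d w *+ 2] vanishes. *)
Lemma ker_killed2 y w : y \in L -> f y != p -> w \in L -> f w = 0 ->
  d w *+ 2 = 0.
Proof.
move=> Ly fy Lw fw.
have ew : e w = - d w.
  by apply/eqP; rewrite eq_sym eqr_oppLR -addr_eq0 -(sum0 Lw) fw add0r.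
have cv n : d y + d w *+ n = q \/ e y - d w *+ n = r.
  have Ln : y + w *+ n \in L by rewrite rpredD ?rpredMn.
  have := cov Ln; rewrite !raddfD !raddfMn /= fw ew mul0rn addr0 mulNrn.
  by case=> [/eqP|->|->]; [rewrite (negPf fy) | left | right].
have inj c m n : c + d w *+ m = c + d w *+ n -> d w *+ m = d w *+ n.
  exact: addrI.
have injN c m n : c - d w *+ m = c - d w *+ n -> d w *+ m = d w *+ n.
  by move=> /addrI /oppr_inj.
have z2 : d w *+ 0 = d w *+ 1 -> d w *+ 2 = 0.
  by rewrite mulr1n => <-; rewrite mul0rn.
have z2' : d w *+ 1 = d w *+ 2 -> d w *+ 2 = 0.
  by move=> h; rewrite -h; apply: (addrI (d w)); rewrite addr0 mulr1n -mulr2n -h.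
case: (cv 0) => h0; case: (cv 1) => h1; case: (cv 2) => h2;
  first [ by apply: z2; apply: (inj (d y)); rewrite h0 h1
        | by apply: z2; apply: (injN (e y)); rewrite h0 h1
        | by apply: z2'; apply: (inj (d y)); rewrite h1 h2
        | by apply: z2'; apply: (injN (e y)); rewrite h1 h2
        | by rewrite -(inj (d y) 0 2) ?mulr0n // h0 h2
        | by rewrite -(injN (e y) 0 2) ?mulr0n // h0 h2 ].
Qed.

(* If [d] does not vanish on [w], it separates [y] from [y + w]; so away from
   the coset [f = p] the other two alternate along [w], which pins down the
   value of [d + e = - f] there. *)
Lemma two_values y w : y \in L -> f y != p -> w \in L -> f w = 0 ->
  d w != 0 -> f y = - (q + r + d w).
Proof.
move=> Ly fy Lw fw dw.
have dw2 := ker_killed2 Ly fy Lw fw.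
have ew : e w = d w.
  have : d w + e w = 0 by rewrite -(sum0 Lw) fw add0r.
  by rewrite -dw2 => /addrI.
suff de : d y + e y = q + r + d w.
  by apply/eqP; rewrite -addr_eq0 -de addrA sum0.
have Lyw : y + w \in L by apply: rpredD.
have fyw : f (y + w) != p by rewrite raddfD fw addr0.
have K c : c + d w + d w = c by rewrite -addrA -mulr2n dw2 addr0.
case: (cov Ly) => [/eqP|hy|hy]; first by rewrite (negPf fy).
  case: (cov Lyw) => [/eqP|hz|hz]; first by rewrite (negPf fyw).
    by case/eqP: dw; apply: (addrI q); rewrite addr0 -{2}hz raddfD hy.
  by rewrite -hz raddfD ew hy -addrA K.
case: (cov Lyw) => [/eqP|hz|hz]; first by rewrite (negPf fyw).
  by rewrite -hz raddfD hy addrAC K.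
by case/eqP: dw; apply: (addrI r); rewrite addr0 -{2}hz raddfD hy ew.
Qed.

(** A [w] in the kernel of [f] with [d w != 0] leaves [f] at most two values on [L], by
    [two_values]. So two of [0], [f y], [f y *+ 2] coincide, and each coincidence gives
    [f y *+ 2 = 0]. *)
Lemma ker_sub_or_killed2 : ~~ killed 1 f ->
  killed 2 f \/ (forall w, w \in L -> f w = 0 -> d w = 0).
Proof.
move=> nf.
have [h|] := boolP [forall (w | w \in L), (f w == 0) ==> (d w == 0)].
  by right=> w Lw /eqP fw; move/forall_inP/(_ w Lw)/implyP/(_ fw)/eqP: h.
rewrite negb_forall => /existsP[w]; rewrite !negb_imply.
case/and3P=> Lw /eqP fw dw; left.
set t := - (q + r + d w).
have val y : y \in L -> f y = p \/ f y = t.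
  by move=> Ly; have [->|fy] := eqVneq (f y) p; [left | right; apply: two_values].
apply/killedP => y Ly.
have L2 : y *+ 2 \in L by rewrite rpredMn.
have same : f y *+ 2 = f y -> f y *+ 2 = 0.
  by move=> h; rewrite h; apply: (addrI (f y)); rewrite addr0 -mulr2n.
have := val _ L2; have := val _ Ly; have := val _ (rpred0 L).
rewrite raddf0 raddfMn /=.
have zero : f y = 0 -> f y *+ 2 = 0 by move=> ->; rewrite mul0rn.
by case=> h0 [] h1 [] h2;
  first [ by rewrite h2 h0 | by apply: same; rewrite h2 h1
        | by apply: zero; rewrite h1 h0 ].
Qed.

(** Since [f] vanishes on doubles, [ker_killed2] applies to [w *+ 2]. *)
Lemma killed4_of_killed2 : ~~ killed 1 f -> killed 2 f -> killed 4 d.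
Proof.
move=> nf /killedP f2.
(* The base point off the coset [f = p] is [0] unless [p = 0], and then any point where [f] does not
   vanish. *)
have [y Ly fy] : exists2 y, y \in L & f y != p.
  have [p0|p0] := eqVneq p 0; last by exists 0; rewrite ?rpred0 // raddf0 eq_sym.
  by case/killedPn: nf => y Ly; rewrite mulr1n => fy; exists y; rewrite ?p0.
apply/killedP => w Lw.
have L2 : w *+ 2 \in L by rewrite rpredMn.
have := ker_killed2 Ly fy L2.
by rewrite !raddfMn f2 // -mulrnA; apply.
Qed.

(** Two of the four points [0], [y], [y *+ 2], [y *+ 3] share a coset, and their difference lies in
    the kernel of [f]. *)
Lemma same_ker_killed :
  (forall w, w \in L -> d w = 0 -> f w = 0) ->
  (forall w, w \in L -> e w = 0 -> f w = 0) -> killed 2 f || killed 3 f.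
Proof.
move=> df ef; apply: killed_or => y Ly.
have cv n : [\/ f (y *+ n) = p, d (y *+ n) = q | e (y *+ n) = r].
  by apply: cov; rewrite rpredMn.
have same (c : {additive V -> A}) s m n :
    (forall w, w \in L -> c w = 0 -> f w = 0) -> (m <= n)%N ->
    c (y *+ m) = s -> c (y *+ n) = s -> f y *+ (n - m) = 0.
  move=> cf mn cm; rewrite -(subnKC mn) mulrnDr raddfD cm -[RHS]addr0 => /addrI h.
  by rewrite addKn -raddfMn; apply: cf => //; rewrite rpredMn.
have key m n : (m <= n)%N -> [\/ f (y *+ m) = p /\ f (y *+ n) = p,
    d (y *+ m) = q /\ d (y *+ n) = q | e (y *+ m) = r /\ e (y *+ n) = r] ->
    f y *+ (n - m) = 0.
  by move=> mn [] [hm hn]; apply: same mn hm hn.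
have one : f y *+ 1 = 0 -> f y *+ 2 = 0 \/ f y *+ 3 = 0.
  by rewrite mulr1n => ->; left; rewrite mul0rn.
let pick := first [by constructor 1 | by constructor 2 | by constructor 3] in
case: (cv 0) => h0; case: (cv 1) => h1; case: (cv 2) => h2; case: (cv 3) => h3;
  first [ by apply/one/(@key 0 1) => //; pick
        | by apply/one/(@key 1 2) => //; pick
        | by apply/one/(@key 2 3) => //; pick
        | by left; apply: (@key 0 2) => //; pick
        | by left; apply: (@key 1 3) => //; pick
        | by right; apply: (@key 0 3) => //; pick ].
Qed.

End ThreeCosets.

(** Bundles the two hypotheses so that the three maps can be permuted. *)
Definition coset_cover f d e p q r :=
  sum_zero f d e /\ forall y, y \in L -> [\/ f y = p, d y = q | e y = r].

Lemma coset_coverC f d e p q r :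
  coset_cover f d e p q r -> coset_cover d f e q p r.
Proof.
case=> sum0 cov; split=> y Ly; first by rewrite [d y + _]addrC sum0.
by case: (cov y Ly); [constructor 2 | constructor 1 | constructor 3].
Qed.

Lemma coset_coverAC f d e p q r :
  coset_cover f d e p q r -> coset_cover f e d p r q.
Proof.
case=> sum0 cov; split=> y Ly; first by rewrite addrAC sum0.
by case: (cov y Ly); [constructor 1 | constructor 3 | constructor 2].
Qed.

Lemma coset_cover_killed2 f d e p q r : coset_cover f d e p q r ->
  ~~ killed 1 f -> killed 2 f -> [&& killed 4 f, killed 4 d & killed 4 e].
Proof.
move=> cov nf f2; apply/and3P; split.
- apply/killedP => y Ly; rewrite (mulrnA _ 2 2).
  by move/killedP: f2 => ->; rewrite ?mul0rn.
- by case: cov => sum0 cov; apply: killed4_of_killed2 sum0 cov nf f2.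
- by case/coset_coverAC: cov => sum0 cov; apply: killed4_of_killed2 sum0 cov nf f2.
Qed.

(** Otherwise the other two cosets cover [L], and [two_coset_cover] makes [f] vanish there. *)
Lemma coset_cover_hit f d e p q r :
  (forall s t : A, s *+ 2 = 0 -> t *+ 2 = 0 -> s != 0 -> t != 0 -> s = t) ->
  coset_cover f d e p q r -> ~~ killed 1 f -> ~~ killed 1 d -> ~~ killed 1 e ->
  exists2 y, y \in L & f y = p.
Proof.
move=> inv [sum0 cov] nf nd ne.
have [/exists_inP[y Ly /eqP fy]|] := boolP [exists (y | y \in L), f y == p].
  by exists y.
move=> /exists_inPn miss; case/negP: nf.
apply: (two_coset_cover (q := q) (r := r) inv sum0 nd ne) => y Ly.
case: (cov y Ly) => [fy|dy|ey]; [|by left|by right].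
by have := miss y Ly; rewrite fy eqxx.
Qed.

(** If 2 kills none of the maps, [ker_sub_or_killed2] makes their kernels in [L] coincide, and
    [same_ker_killed] leaves only 3. *)
Lemma three_coset_cover f d e p q r : coset_cover f d e p q r ->
  ~~ killed 1 f -> ~~ killed 1 d -> ~~ killed 1 e ->
  [&& killed 3 f, killed 3 d & killed 3 e] \/
  [|| killed 2 f, killed 2 d | killed 2 e] /\
  [&& killed 4 f, killed 4 d & killed 4 e].
Proof.
move=> cov nf nd ne.
have [two|/norP[f2 /norP[d2 e2]]] :=
  boolP [|| killed 2 f, killed 2 d | killed 2 e].
  right; split=> //; case/or3P: two => two.
  - exact: coset_cover_killed2 cov nf two.
  - by have /and3P[-> -> ->] := coset_cover_killed2 (coset_coverC cov) nd two.
  - have := coset_cover_killed2 (coset_coverC (coset_coverAC cov)) ne two.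
    by case/and3P=> -> -> ->.
left.
have sub f' d' e' p' q' r' : coset_cover f' d' e' p' q' r' -> ~~ killed 1 f' ->
    ~~ killed 2 f' -> forall w, w \in L -> f' w = 0 -> d' w = 0.
  move=> [sum0 cov'] nf' f2'.
  by case: (ker_sub_or_killed2 sum0 cov' nf') => // h; rewrite h in f2'.
have fd := sub _ _ _ _ _ _ cov nf f2.
have fe := sub _ _ _ _ _ _ (coset_coverAC cov) nf f2.
have df := sub _ _ _ _ _ _ (coset_coverC cov) nd d2.
have ef := sub _ _ _ _ _ _ (coset_coverC (coset_coverAC cov)) ne e2.
have /orP[h|f3] := same_ker_killed (proj2 cov) df ef; first by rewrite h in f2.
have k3 (c : {additive V -> A}) :
    (forall w, w \in L -> f w = 0 -> c w = 0) -> killed 3 c.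
  move=> fc; apply/killedP => y Ly; rewrite -raddfMn; apply: fc; rewrite ?rpredMn //.
  by rewrite raddfMn; move/killedP: f3 => ->.
by rewrite f3 !k3.
Qed.

End CosetCovers.

(** * Elements outside two kernels *)

Section KernelPair.

Variables (V A : zmodType) (f d : {additive V -> A}).

Definition ker2 : {pred V} := [pred y | (f y == 0) && (d y == 0)].

Fact ker2_zmod_closed : zmod_closed ker2.
Proof.
split=> [|x y]; rewrite !inE ?raddf0 ?eqxx // => /andP[/eqP fx /eqP dx].
by move=> /andP[/eqP fy /eqP dy]; rewrite !raddfB fx fy dx dy subrr eqxx.
Qed.

HB.instance Definition _ := GRing.isZmodClosed.Build V ker2 ker2_zmod_closed.

(* If [z] lies in the kernel of [f], then [z + s] or [z - s] avoids both
   kernels, for any [s] with [f s != 0] and [2 d s != 0]. *)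
Lemma ker_avoiding_span (B : zmodType) (h : {additive V -> B}) k s :
  f s != 0 -> d s *+ 2 != 0 ->
  (forall x, f x != 0 -> d x != 0 -> h x *+ k = 0) ->
  forall z, f z = 0 -> h z *+ k = 0.
Proof.
move=> fs ds hS z fz.
have ds1 : d s != 0 by apply: contraNneq ds => ->; rewrite mul0rn.
have hs : h s *+ k = 0 by apply: hS.
have [dz|dz] := eqVneq (d (z + s)) 0; last first.
  have : h (z + s) *+ k = 0 by apply: hS; rewrite // raddfD fz add0r.
  by rewrite raddfD mulrnDl hs addr0.
have : h (z - s) *+ k = 0; last by rewrite raddfB mulrnBl hs subr0.
apply: hS; first by rewrite raddfB fz sub0r oppr_eq0.
move: dz; rewrite raddfD => /eqP; rewrite addr_eq0 => /eqP dz.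
by rewrite raddfB dz -opprD oppr_eq0 -mulr2n.
Qed.

End KernelPair.

(** * Torsion in Z_N *)

Section Zmodulus.

Variable N : nat.
Hypothesis N_gt1 : (1 < N)%N.

Lemma Zp_mulrn_eq0 (x : 'Z_N) n : (x *+ n == 0) = (N %| n * x)%N.
Proof.
by rewrite -{1}[x]natr_Zp -mulrnA -val_eqE /= val_Zp_nat // mulnC.
Qed.

(** The representative can only be N/2: its double is a positive multiple of [N] below [2 * N]. *)
Lemma Zp_involution_unique (s t : 'Z_N) :
  s *+ 2 = 0 -> t *+ 2 = 0 -> s != 0 -> t != 0 -> s = t.
Proof.
have half (x : 'Z_N) : x *+ 2 = 0 -> x != 0 -> (2 * x)%N = N.
  move=> /eqP; rewrite Zp_mulrn_eq0 => /dvdnP[[|[|k]] xk] x0.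
  - by case/eqP: x0; apply: val_inj => /=; move: xk; case: (nat_of_ord x).
  - by rewrite xk mul1n.
  - have := ltn_ord x; rewrite [X in (_ < X)%N]Zp_cast // => xN.
    have := leq_mul2l 2 N x.
    by rewrite xk leq_mul2r orbT leqNgt xN.
move=> s2 t2 s0 t0; apply: val_inj => /=.
have /eqP := etrans (half s s2 s0) (esym (half t t2 t0)).
by rewrite eqn_pmul2l // => /eqP.
Qed.

End Zmodulus.

(** * Coordinates of codewords as homomorphisms, and their annihilators *)

Section Coordinates.

Variables (N k n : nat) (g : 'M['Z_N]_(k, n)) (i : 'I_n).

Definition code_coord (u : 'rV['Z_N]_k) : 'Z_N := (u *m g) 0 i.

Fact code_coord_is_zmod_morphism : zmod_morphism code_coord.
Proof. by move=> u v; rewrite /code_coord mulmxBl !mxE. Qed.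

HB.instance Definition _ :=
  GRing.isZmodMorphism.Build 'rV['Z_N]_k 'Z_N code_coord
    code_coord_is_zmod_morphism.

End Coordinates.

(** For a code of gcd 1 this bounds [N]: an [m] killing all coordinates is a multiple of [N]. *)
Lemma dvdn_code_gcd (N k n m : nat) (g : 'M['Z_N]_(k, n)) : (1 < N)%N ->
  (forall i u, code_coord g i u *+ m = 0) -> (N %| m * code_gcd (gen_code g))%N.
Proof.
move=> N1 h; rewrite /code_gcd.
have gc x y : (N %| m * x -> N %| m * y -> N %| m * gcdn x y)%N.
  by move=> hx hy; rewrite muln_gcdr dvdn_gcd hx.
apply: (big_ind (fun x => N %| m * x)%N) => [|//|w /imsetP[u _ ->]].
  exact: dvdn_mull.
apply: (big_ind (fun x => N %| m * x)%N) => [|//|i _]; first by rewrite muln0.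
by rewrite -Zp_mulrn_eq0 //; apply/eqP/h.
Qed.

Lemma code_coord_killed (N n m : nat) (g : 'M['Z_N]_(2, n)) i : (1 < N)%N ->
  (forall u, code_coord g i u *+ m = 0) <-> (N %| m * col_gcd g i)%N.
Proof.
move=> N1; rewrite /col_gcd !muln_gcdr !dvdn_gcd (dvdn_mull m (dvdnn N)) andbT.
rewrite -!Zp_mulrn_eq0 //; split=> [h|/andP[/eqP h0 /eqP h1] u].
  by apply/andP; split; apply/eqP;
    [rewrite -(h (delta_mx 0 0)) | rewrite -(h (delta_mx 0 1))];
    rewrite /code_coord -rowE mxE.
rewrite /code_coord mxE big_ord_recl big_ord1 mulrnDl -!mulrnAr h0.
rewrite (_ : lift ord0 ord0 = 1) ?h1 ?mulr0 ?addr0 //; exact: val_inj.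
Qed.

Lemma sum_split_pair (A : zmodType) (a b : 'I_5) : a != b ->
  exists c d e, [/\
    c \notin [set a; b], d \notin [set a; b], e \notin [set a; b],
    forall i, i \in [:: a; b; c; d; e]
    & forall F : 'I_5 -> A, \sum_i F i = F a + F b + (F c + F d + F e)].
Proof.
move=> ab; set S := [set a; b].
have cS : #|~: S| = 3 by rewrite cardsCs setCK cards2 ab card_ord.
have [c cC] : exists c, c \in ~: S by apply/card_gt0P; rewrite cS.
have : #|~: S :\ c| == 2 by move: cS; rewrite (cardsD1 c) cC add1n => -[->].
case/cards2P=> d [e [de dE]].
have memC i : i \in ~: S -> i != c -> i \in [set d; e].
  by move=> iS ic; rewrite -dE in_setD1 ic.
have dC : d \in ~: S :\ c by rewrite dE !inE eqxx.
have eC : e \in ~: S :\ c by rewrite dE !inE eqxx orbT.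
have [/setD1P[dc dS] /setD1P[ec eS]] := (dC, eC).
exists c, d, e; split=> [||||F]; try by rewrite -in_setC.
  move=> i; rewrite !inE; have [iS|iS] := boolP (i \in S).
    by move: iS; rewrite !inE => /orP[->|->]; rewrite ?orbT.
  have [->|ic] := eqVneq i c; first by rewrite !orbT.
  have := memC i; rewrite in_setC iS => /(_ isT ic).
  by rewrite !inE => /orP[->|->]; rewrite !orbT.
rewrite (bigID (mem S)) /=; congr (_ + _).
  by rewrite /S big_setU1 ?inE //= big_set1.
rewrite (eq_bigl (mem (~: S))) => [|i]; last by rewrite /= in_setC.
by rewrite (big_setD1 c) //= dE big_setU1 ?inE //= big_set1 addrA.
Qed.

(* Thin codes with two columns of gcd N/alpha *)
Local Close Scope ring_scope.

Theorem lemma3p7 (N alpha : nat) (hN : 9 <= N)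
  (halpha : alpha \in [:: 2; 3; 4]) (hdvd : alpha %| N)
  (g : 'M['Z_N]_(2, 5)) (hadm : admissible (gen_code g))
  (htwo : #|[set i : 'I_5 | col_gcd g i == N %/ alpha]| = 2)
  (hother : forall i : 'I_5, col_gcd g i <> N %/ alpha ->
     col_gcd g i < N %/ alpha) :
  ~ (thin (gen_code g) /\ ~ degenerate (gen_code g)).
Proof.
Local Open Scope ring_scope.
move=> [[ext thin] _].
have N1 : (1 < N)%N by apply: leq_trans hN.
have alpha_gt1 : (1 < alpha)%N by move: halpha; rewrite !inE => /or3P[] /eqP ->.
have N_E : (alpha * (N %/ alpha) = N)%N by rewrite mulnC divnK.
pose phi i := code_coord g i : {additive 'rV['Z_N]_2 -> 'Z_N}.
have phi_zero u : exists i, phi i u = 0.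
  have [/existsP[i /eqP h]|h] := boolP [exists i, phi i u == 0].
    by exists i.
  case: thin; exists (u *m g); first by apply/imsetP; exists u.
  by move=> i; move: h; rewrite negb_exists => /forallP/(_ i).
have phi_sum u : \sum_i phi i u = 0 by apply: ext; apply/imsetP; exists u.
have not_kill i m : ~ (N %| m * col_gcd g i)%N -> exists u, phi i u *+ m != 0.
  move=> h; have [/existsP[u]|] := boolP [exists u, phi i u *+ m != 0].
    by exists u.
  rewrite negb_exists => /forallP k; case: h; apply/code_coord_killed => // u.
  by apply/eqP; have := k u; rewrite negbK.
have gcd_gt0 i : (0 < col_gcd g i)%N by rewrite gcdn_gt0 (ltnW N1) orbT.
have /cards2P[a [b [ab abE]]] :
    #|[set i : 'I_5 | col_gcd g i == (N %/ alpha)%N]| == 2.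
  exact/eqP.
have gcd_ab i : i \in [set a; b] -> col_gcd g i = (N %/ alpha)%N.
  by rewrite -abE inE => /eqP.
have alpha_ab i u : i \in [set a; b] -> phi i u *+ alpha = 0.
  by move=> iab; move: u; apply/code_coord_killed => //; rewrite gcd_ab // N_E.
have not_kill_ab i m : (0 < m < alpha)%N -> i \in [set a; b] ->
    exists u, phi i u *+ m != 0.
  move=> /andP[m0 ma] iab; apply: not_kill; rewrite gcd_ab //.
  move/dvdn_leq; rewrite muln_gt0 m0 divn_gt0 ?(ltnW alpha_gt1) //.
  rewrite dvdn_leq ?(ltnW N1) // => /(_ isT); rewrite -{1}N_E leq_pmul2r; first by rewrite leqNgt ma.
  by rewrite divn_gt0 ?(ltnW alpha_gt1) // dvdn_leq ?(ltnW N1).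
(* Here [m = alpha] is allowed, because the gcd is strictly below [N %/ alpha]. *)
have not_kill_other i m : (0 < m <= alpha)%N -> i \notin [set a; b] ->
    exists u, phi i u *+ m != 0.
  move=> /andP[m0 ma]; rewrite -abE inE => /eqP/hother lt; apply: not_kill.
  move/dvdn_leq; rewrite muln_gt0 m0 gcd_gt0 => /(_ isT); apply/negP.
  rewrite -ltnNge -{2}N_E (leq_ltn_trans (leq_mul ma (leqnn _))) //.
  by rewrite ltn_pmul2l // (ltnW alpha_gt1).
have [aab bab] : a \in [set a; b] /\ b \in [set a; b] by rewrite !inE !eqxx orbT.
have [c [d [e [cab dab eab all5 sum5]]]] := sum_split_pair 'Z_N ab.
pose L : zmodClosed 'rV['Z_N]_2 := ker2 (phi a) (phi b).
have L_alpha u : u *+ alpha \in L by rewrite !inE !raddfMn !alpha_ab ?eqxx.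
have nk i : i \notin [set a; b] -> ~~ killed L 1 (phi i).
  move=> iab; have [|u h] := @not_kill_other i alpha _ iab.
    by rewrite (ltnW alpha_gt1) leqnn.
  by apply/killedPn; exists (u *+ alpha); rewrite // mulr1n raddfMn.
have [nc nd ne] := And3 (nk c cab) (nk d dab) (nk e eab).
(* Some coordinate vanishes at [x + y]; on columns [a] and [b] it has the same nonzero value as at
   [x], so the zero is in one of [c], [d], [e]. *)
have cover x : phi a x != 0 -> phi b x != 0 ->
    coset_cover L (phi c) (phi d) (phi e) (- phi c x) (- phi d x) (- phi e x).
  move=> ax bx; split=> y; rewrite !inE => /andP[/eqP ay /eqP by0].
    by have := phi_sum y; rewrite sum5 ay by0 !add0r.
  have neg i : phi i (x + y) = 0 -> phi i y = - phi i x.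
    by rewrite raddfD addrC => /eqP; rewrite addr_eq0 => /eqP.
  have [i h] := phi_zero (x + y); move: (all5 i); rewrite !inE.
  case/or4P=> [/eqP E|/eqP E|/eqP E|/orP[] /eqP E]; subst i.
  - by move: h; rewrite raddfD ay addr0 => /eqP; rewrite (negPf ax).
  - by move: h; rewrite raddfD by0 addr0 => /eqP; rewrite (negPf bx).
  - by constructor 1; apply: neg.
  - by constructor 2; apply: neg.
  - by constructor 3; apply: neg.
have pair m n i j :
    (exists u, phi i u *+ m != 0) -> (exists u, phi j u *+ n != 0) ->
    exists2 x, phi i x *+ m != 0 & phi j x *+ n != 0.
  by move=> [u hu] [v hv]; have [x _ /andP[]] := avoid_kernels hu hv; exists x.
have [x] : exists2 x, phi a x *+ 1 != 0 & phi b x *+ 1 != 0.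
  by apply: pair; apply: not_kill_ab.
rewrite !mulr1n => ax bx.
have split5 i : i \in [set a; b] \/ [\/ i = c, i = d | i = e].
  have := all5 i; rewrite !inE.
  by case/or4P=> [->|->|/eqP->|/orP[] /eqP->]; rewrite ?orbT; auto;
    right; [constructor 1 | constructor 2 | constructor 3].
(* All [u *+ alpha] lie in [L], so [k * alpha] kills every column. *)
have N_le k : (0 < k)%N -> killed L k (phi c) -> killed L k (phi d) ->
    killed L k (phi e) -> (N <= k * alpha)%N.
  move=> k0 kc kd ke; apply: dvdn_leq.
    by rewrite muln_gt0 k0 (ltnW alpha_gt1).
  rewrite -[X in (_ %| X)%N]muln1 -(proj2 hadm); apply: dvdn_code_gcd => // i u.
  rewrite -/(phi i u) mulnC mulrnA.
  case: (split5 i) => [iab|]; first by rewrite alpha_ab ?mul0rn.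
  move/killedP: kc => kc; move/killedP: kd => kd; move/killedP: ke => ke.
  by case=> ->; [have := kc _ (L_alpha u) | have := kd _ (L_alpha u)
    | have := ke _ (L_alpha u)]; rewrite raddfMn.
have hit i z : i \notin [set a; b] -> phi a z != 0 -> phi b z != 0 ->
    exists2 y, y \in L & phi i y = - phi i z.
  move=> iab az bz; have cov := cover z az bz.
  have inv := Zp_involution_unique N1.
  case: (split5 i) => [|[]->]; first by rewrite (negPf iab).
  - exact: (coset_cover_hit inv cov).
  - exact: (coset_cover_hit inv (coset_coverC cov)).
  - exact: (coset_cover_hit inv (coset_coverC (coset_coverAC cov))).
(* For [z] off both kernels, [hit] makes [- phi i z] a value of [phi i] on [L], so [k] kills it;
   [ker_avoiding_span] extends this to all vectors, against [not_kill_other] since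
   [k <= 3 <= alpha]. *)
have large k i : (2 < alpha)%N -> (0 < k <= 3)%N -> i \notin [set a; b] ->
    ~~ killed L k (phi i).
  move=> alpha2 /andP[k0 k3] iab; apply/negP => /killedP ki.
  have [u /eqP[]] : exists u, phi i u *+ k != 0.
    by apply: not_kill_other; rewrite // k0 (leq_trans k3).
  have off z : phi a z != 0 -> phi b z != 0 -> phi i z *+ k = 0.
    move=> az bz; have [y Ly yz] := hit i z iab az bz.
    by apply/eqP; rewrite -oppr_eq0 -mulNrn -yz ki.
  (* The multiplier 2 is where [2 < alpha] enters. *)
  have [s as1 bs2] : exists2 s, phi a s *+ 1 != 0 & phi b s *+ 2 != 0.
    by apply: pair; apply: not_kill_ab.
  have [t bt1 at2] : exists2 t, phi b t *+ 1 != 0 & phi a t *+ 2 != 0.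
    by apply: pair; apply: not_kill_ab.
  have [au|au] := eqVneq (phi a u) 0; first
    exact: (ker_avoiding_span as1 bs2 off).
  have [bu|bu] := eqVneq (phi b u) 0; last exact: off.
  by apply: (ker_avoiding_span bt1 at2 _ bu) => z bz az; apply: off.
have small k : (k <= 4)%N -> (alpha <= 2)%N -> ~ (N <= k * alpha)%N.
  move=> k4 alpha2 /(leq_trans hN).
  by move/leq_trans/(_ (leq_mul k4 alpha2)).
case: (three_coset_cover (cover x ax bx) nc nd ne) => [/and3P[kc kd ke]|].
  have [alpha2|alpha2] := leqP alpha 2.
    exact: (small 3 _ _ (N_le 3 _ kc kd ke)).
  by case/negP: (large 3 c alpha2 isT cab).
case=> two /and3P[kc kd ke].
have [alpha2|alpha2] := leqP alpha 2.
  exact: (small 4 _ _ (N_le 4 _ kc kd ke)).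
by case/or3P: two => h; [case/negP: (large 2 c alpha2 isT cab)
  | case/negP: (large 2 d alpha2 isT dab) | case/negP: (large 2 e alpha2 isT eab)].
Qed.
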